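(* Let $\mathbb{Q}^+=\{r\in\mathbb{Q}\mid r>0\}$ and let $\mathcal{L}=\langle 1,\cdot,{}^{-1},<,R_2,R_3,\ldots\rangle$. The structure $\langle\mathbb{Q}^+,\mathcal{L}\rangle$ admits quantifier elimination: for every first-order $\mathcal{L}$-formula $\varphi(x_1,\ldots,x_n)$ there is a quantifier-free $\mathcal{L}$-formula $\psi(x_1,\ldots,x_n)$ such that for all $a_1,\ldots,a_n\in\mathbb{Q}^+$, $\varphi(a_1,\ldots,a_n)$ holds in $\langle\mathbb{Q}^+,\mathcal{L}\rangle$ if and only if $\psi(a_1,\ldots,a_n)$ does.
   Context: The symbols of $\mathcal{L}$ are interpreted in $\mathbb{Q}^+$ as follows: $1$ is the number one, $\cdot$ is multiplication, ${}^{-1}$ is the multiplicative inverse, $<$ is the usual strict order, and for each integer $n\geqslant 2$, $R_n$ is the unary predicate ''being the $n$th power of a rational'', i.e. for $x \in \mathbb{Q}^+$, $R_n(x)$ holds if and only if there exists $y\in\mathbb{Q}^+$ with $x=y^n$. (For positive rational $x$, being an $n$th power of a rational and of a positive rational are the same.) *)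

(* Defs.v *)
From mathcomp Require Import all_boot all_order all_algebra.

Set Implicit Arguments.
Unset Strict Implicit.
Unset Printing Implicit Defensive.

Import Order.TTheory GRing.Theory Num.Theory.

Local Open Scope ring_scope.

(* Well-scoped de Bruijn syntax: an element of [formula n] is a first-order
   formula, with equality, whose free variables are among n variables, indexed
   by ['I_n]; a quantifier binds the variable of index 0 and shifts the others
   by one. *)

Inductive term (n : nat) : Type :=
| TVar of 'I_n
| TOne
| TMul of term n & term n
| TInv of term n.

Arguments TOne {n}.

Inductive formula : nat -> Type :=
| FEq n of term n & term n : formula n
| FLt n of term n & term n : formula n
| FRoot n (k : nat) of (2 <= k)%N & term n : formula n  (* the symbol R_k *)
| FNot n of formula n : formula n
| FAnd n of formula n & formula n : formula n
| FOr n of formula n & formula n : formula n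
| FImp n of formula n & formula n : formula n
| FAll n of formula n.+1 : formula n
| FEx n of formula n.+1 : formula n.

Fixpoint quantifier_free n (phi : formula n) : bool :=
  match phi with
  | FEq _ _ _ | FLt _ _ _ | FRoot _ _ _ _ => true
  | FNot _ f => quantifier_free f
  | FAnd _ f g | FOr _ f g | FImp _ f g =>
      quantifier_free f && quantifier_free g
  | FAll _ _ | FEx _ _ => false
  end.

Definition qpos : Type := {r : rat | 0 < r}.

Definition qpos_one : qpos := exist _ 1 ltr01.

Definition qpos_mul (x y : qpos) : qpos :=
  exist _ (val x * val y) (mulr_gt0 (valP x) (valP y)).

Lemma qpos_inv_gt0 (x : qpos) : 0 < (val x)^-1.
Proof. by rewrite invr_gt0 (valP x). Qed.

Definition qpos_inv (x : qpos) : qpos := exist _ (val x)^-1 (qpos_inv_gt0 x).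

Definition qpos_lt (x y : qpos) : Prop := val x < val y.

Definition qpos_is_power (k : nat) (x : qpos) : Prop :=
  exists y : qpos, val x = val y ^+ k.

Fixpoint eval n (a : n.-tuple qpos) (t : term n) : qpos :=
  match t with
  | TVar i => tnth a i
  | TOne => qpos_one
  | TMul t1 t2 => qpos_mul (eval a t1) (eval a t2)
  | TInv t1 => qpos_inv (eval a t1)
  end.

Fixpoint holds n (phi : formula n) : n.-tuple qpos -> Prop :=
  match phi in formula m return m.-tuple qpos -> Prop with
  | FEq _ t u => fun a => eval a t = eval a u
  | FLt _ t u => fun a => qpos_lt (eval a t) (eval a u)
  | FRoot _ k _ t => fun a => qpos_is_power k (eval a t)
  | FNot _ f => fun a => ~ holds f a
  | FAnd _ f g => fun a => holds f a /\ holds g a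
  | FOr _ f g => fun a => holds f a \/ holds g a
  | FImp _ f g => fun a => holds f a -> holds g a
  | FAll _ f => fun a => forall x : qpos, holds f [tuple of x :: a]
  | FEx _ f => fun a => exists x : qpos, holds f [tuple of x :: a]
  end.

(* Main.v *)
Require Import Defs.
From mathcomp Require Import all_boot all_order all_algebra.
From mathcomp Require Import ring lra.
From Stdlib Require Import Classical.

(** To eliminate [exists x], raise the atoms to suitable powers so that [x] only
    occurs as [y = x ^ M], the condition [R_M y] being added to the formula, and
    pass to a disjunctive normal form. An equation [y = t] is eliminated by
    substitution. Otherwise the condition on [y] is an interval [l < y < u]
    together with coset conditions [R_k (y v)] and [~ R_l (y z)]. The latter are
    invariant under multiplication by K'-th powers for some K' > 0, and these
    powers are dense, so the interval only has to be nonempty. By the Chinese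
    remainder theorem in the torsion-free group Q+, the positive conditions are
    jointly solvable iff they are pairwise compatible, and a solution [y0] is
    then unique up to K-th powers, where K is the lcm of the moduli. A negative
    condition with [l | K] holds for all solutions or for none; the conditions
    with [~ l | K] are satisfied together by [y0 * p ^ K] for a prime [p] foreign
    to all the data. *)

Set Implicit Arguments.
Unset Strict Implicit.
Unset Printing Implicit Defensive.

Import Order.TTheory GRing.Theory Num.Theory.
Local Open Scope ring_scope.

(** * Powers in the group of positive rationals *)

Definition is_pow (k : nat) (x : rat) : Prop := exists2 y : rat, 0 < y & x = y ^+ k.

Lemma is_pow_gt0 k x : is_pow k x -> 0 < x.
Proof. by move=> [y y0 ->]; rewrite exprn_gt0. Qed.

Lemma is_powX k (x : rat) : 0 < x -> is_pow k (x ^+ k).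
Proof. by exists x. Qed.

Lemma is_powM k x y : is_pow k x -> is_pow k y -> is_pow k (x * y).
Proof. by move=> [u u0 ->] [v v0 ->]; exists (u * v); rewrite ?mulr_gt0 ?exprMn. Qed.

Lemma is_powV k x : is_pow k x -> is_pow k x^-1.
Proof. by move=> [u u0 ->]; exists u^-1; rewrite ?invr_gt0 ?exprVn. Qed.

Lemma is_powMr k x y : is_pow k y -> is_pow k (x * y) <-> is_pow k x.
Proof.
move=> ky; have y0 := is_pow_gt0 ky; split=> [kxy|kx]; last exact: is_powM.
by rewrite -[x](mulfK (lt0r_neq0 y0)); apply/is_powM/is_powV.
Qed.

Lemma is_pow_dvd d k x : (d %| k)%N -> is_pow k x -> is_pow d x.
Proof.
by move=> /dvdnP[q ->] [y y0 ->]; exists (y ^+ q); rewrite ?exprn_gt0 ?exprM.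
Qed.

Lemma is_pow1 x : is_pow 1 x <-> 0 < x.
Proof. by split=> [/is_pow_gt0|x0] //; exists x; rewrite ?expr1. Qed.

(** Positive [e]-th roots are unique, so an equality of [e]-th powers can be cancelled. *)
Lemma is_powXX e k x : (0 < e)%N -> 0 < x -> is_pow (k * e) (x ^+ e) <-> is_pow k x.
Proof.
move=> e0 x0; split=> -[y y0 exy]; exists y => //.
  by apply/eqP; rewrite -(eqrXn2 e0) ?ltW ?exprn_gt0 // exy exprM.
by rewrite exy exprM.
Qed.

(** With [a = a' d], [b = b' d] and [i a' = j b' + 1], the roots in [y ^ a = z ^ b] satisfy
    [y ^ a' = z ^ b'] by torsion-freeness, and then [z ^ i / y ^ j] is a [b']-th root of [y]. *)
Lemma is_pow_lcm a b x : (0 < a)%N -> (0 < b)%N ->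
  is_pow a x -> is_pow b x -> is_pow (lcmn a b) x.
Proof.
move=> a0 b0 [y y0 ->] [z z0 eyz].
have [i j eij _] := egcdnP b a0.
have /dvdnP[a' ea] := dvdn_gcdl a b; have /dvdnP[b' eb] := dvdn_gcdr a b.
set d := gcdn a b in eij ea eb.
have d0 : (0 < d)%N by rewrite gcdn_gt0 a0.
have eij' : (i * a' = j * b' + 1)%N.
  by apply/eqP; rewrite -(eqn_pmul2r d0) mulnDl -!mulnA -ea -eb mul1n eij.
have yz : y ^+ a' = z ^+ b'.
  by apply/eqP; rewrite -(eqrXn2 d0) ?exprn_ge0 ?ltW // -!exprM -ea -eb eyz.
exists (z ^+ i / y ^+ j); first by rewrite divr_gt0 ?exprn_gt0.
have -> : lcmn a b = (b' * a)%N by rewrite /lcmn -/d {1}eb mulnA mulnK // mulnC.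
rewrite exprM; congr (_ ^+ a).
rewrite expr_div_n -!exprM [(i * b')%N]mulnC exprM -yz -exprM [(a' * i)%N]mulnC.
by rewrite eij' exprD expr1 mulrC mulKf // expf_neq0 // lt0r_neq0.
Qed.

Lemma biglcmn_gt0 (ks : seq nat) : all (ltn 0) ks -> (0 < \big[lcmn/1]_(k <- ks) k)%N.
Proof.
elim: ks => [|k ks IH] /=; first by rewrite big_nil.
by case/andP=> k0 /IH L0; rewrite big_cons lcmn_gt0 k0.
Qed.

Lemma dvdn_biglcm (ks : seq nat) k : k \in ks -> (k %| \big[lcmn/1]_(k <- ks) k)%N.
Proof.
elim: ks => [//|k' ks IH]; rewrite inE big_cons => /orP[/eqP ->|/IH h].
  exact: dvdn_lcml.
exact: dvdn_trans h (dvdn_lcmr _ _).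
Qed.

(** In the divisibility lattice gcd distributes over lcm, so [is_pow_lcm] absorbs the moduli one at
    a time. *)
Lemma is_pow_gcd_biglcm l (ks : seq nat) x : (0 < l)%N -> all (ltn 0) ks -> 0 < x ->
  {in ks, forall k, is_pow (gcdn l k) x} -> is_pow (gcdn l (\big[lcmn/1]_(k <- ks) k)) x.
Proof.
move=> l0 + x0; elim: ks => [_ _|k ks IH] /=.
  by rewrite big_nil gcdn1; apply/is_pow1.
case/andP=> k0 ks0 h; rewrite big_cons gcdnC Order.NatDvd.meetUl !(gcdnC _ l).
apply: is_pow_lcm; rewrite ?gcdn_gt0 ?l0 //; first by apply: h; rewrite mem_head.
by apply: IH => // k' k'P; apply: h; rewrite inE k'P orbT.
Qed.

(** A Bezout relation [i a = j b + gcdn a b] turns the given power of [g] into an [a]-th power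
    divided by a [b]-th power. *)
Lemma is_pow_gcdP a b x : (0 < a)%N -> is_pow (gcdn a b) x ->
  exists u v, [/\ is_pow a u, is_pow b v & x = u * v].
Proof.
move=> a0 [g g0 ->]; have [i j eij _] := egcdnP b a0.
exists (g ^+ i ^+ a), (g ^+ j ^+ b)^-1.
split; [|apply/is_powV|]; try by apply/is_powX/exprn_gt0.
by rewrite -!exprM eij exprD mulrC mulKf // expf_neq0 // lt0r_neq0.
Qed.

(** Induction on [R]: a solution [y] for the tail may be altered by any [K]-th power, where [K] is
    the lcm of the tail's moduli. This suffices to meet the head condition because compatibility
    makes [y v] a [gcdn k K]-th power. *)
Lemma is_pow_crt (R : seq (nat * rat)) :
  {in R, forall q, (0 < q.1)%N && (0 < q.2)} ->
  {in R &, forall q q', is_pow (gcdn q.1 q'.1) (q.2 / q'.2)} ->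
  exists2 y, 0 < y & {in R, forall q, is_pow q.1 (y * q.2)}.
Proof.
elim: R => [|[k v] R IH] Rpos Rc; first by exists 1.
case: IH => [q qR|q q' qR q'R|y y0 yR].
- by apply: Rpos; rewrite inE qR orbT.
- by apply: Rc; rewrite inE ?qR ?q'R orbT.
have /andP[/= k0 v0] := Rpos _ (mem_head _ _).
have R'pos : {in R, forall q, (0 < q.1)%N && (0 < q.2)}.
  by move=> q qR; apply: Rpos; rewrite inE qR orbT.
pose K := \big[lcmn/1]_(k <- unzip1 R) k.
have yvK : is_pow (gcdn k K) (y * v).
  apply: is_pow_gcd_biglcm => //; last 2 first.
  - by rewrite mulr_gt0.
  - move=> _ /mapP[q qR ->].
    have -> : y * v = (y * q.2) * (v / q.2).
      by have /andP[_ /lt0r_neq0 ?] := R'pos _ qR; field.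
    apply: is_powM; first by apply/(is_pow_dvd (dvdn_gcdr _ _))/yR.
    by apply: (Rc (k, v)); rewrite ?mem_head // inE qR orbT.
  - by apply/allP=> _ /mapP[q qR ->]; case/andP: (R'pos _ qR).
have [u [w [ku Kw e]]] := is_pow_gcdP k0 yvK.
have w0 := is_pow_gt0 Kw.
(* As [y v = u w], dividing by [w] leaves the [k]-th power [u]; the tail conditions survive because
   [w] is a [K]-th power. *)
exists (y / w); first by rewrite divr_gt0.
move=> q; rewrite inE => /orP[/eqP -> /=|qR].
  by rewrite mulrAC e mulfK // lt0r_neq0.
rewrite mulrAC; apply/is_powM/is_powV; first exact: yR.
by apply: is_pow_dvd Kw; apply/dvdn_biglcm/map_f.
Qed.

(** * Density of powers, and primes foreign to given data *)

Lemma bernoulli_le (x : rat) n : 0 <= 1 + x -> 1 + n%:R * x <= (1 + x) ^+ n.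
Proof.
move=> x0; elim: n => [|n IH]; first by rewrite mul0r addr0.
rewrite exprS (le_trans _ (ler_wpM2l x0 IH)) // -natr1.
have := ler0n rat n; nra.
Qed.

(** The [K]-th powers of [1, c, c ^ 2, ...] form a geometric progression. If its ratio [c ^ K] is
    below [b / a], the first member above [a] is still below [b]. *)
Lemma pow_dense (K : nat) (a b : rat) : (0 < K)%N -> 0 < a -> a < b ->
  exists2 r : rat, 0 < r & a < r ^+ K < b.
Proof.
move=> K0 a0 ab.
(* Multiplying the bounds by [N ^ K] with [N > 1 / a] only rescales [r] by [N]. *)
wlog a1 : a b a0 ab / 1 <= a => [H|].
  pose N := Num.Def.archi_bound a^-1.
  have Na : a^-1 < N%:R by rewrite archi_boundP // invr_ge0 ltW.
  have N0 : 0 < N%:R :> rat by rewrite (lt_trans _ Na) ?invr_gt0.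
  have NK0 : 0 < N%:R ^+ K :> rat by rewrite exprn_gt0.
  have N1 : 1 <= N%:R :> rat by rewrite (ler_nat _ 1) -(ltr_nat rat).
  have [|||r r0 /andP[ar rb]] := H (a * N%:R ^+ K) (b * N%:R ^+ K).
  - by rewrite mulr_gt0.
  - by rewrite ltr_pM2r.
  - rewrite mulrC -ler_pdivrMr // div1r (le_trans (ltW Na)) //.
    by rewrite -[leLHS]expr1 ler_weXn2l.
  exists (r / N%:R); first by rewrite divr_gt0.
  by rewrite expr_div_n ltr_pdivlMr // ltr_pdivrMr // ar.
have K0' : 0 < K%:R :> rat by rewrite ltr0n.
have b0 := lt_trans a0 ab.
have q1 : a / b < 1 by rewrite ltr_pdivrMr // mul1r.
have q0 : 0 < a / b by rewrite divr_gt0.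
(* Then [K e] is half of [1 - a / b], so Bernoulli gives [(1 - e) ^ K > a / b], that is
   [a c ^ K < b]. *)
pose e := (1 - a / b) / 2 / K%:R.
have Ke : K%:R * e = (1 - a / b) / 2 by rewrite /e mulrC divfK // lt0r_neq0.
have e0 : 0 < e by rewrite !divr_gt0 // subr_gt0.
have e1 : e < 1.
  have : 1 <= K%:R :> rat by rewrite ler1n.
  by nra.
have c0 : 0 < 1 - e by rewrite subr_gt0.
pose c := (1 - e)^-1.
have cK : a * c ^+ K < b.
  rewrite /c exprVn ltr_pdivrMr ?exprn_gt0 // mulrC -ltr_pdivrMr //.
  by rewrite (lt_le_trans _ (bernoulli_le K (ltW c0))) // mulrN Ke; lra.
have c1 : 0 < c - 1 by rewrite subr_gt0 /c invf_gt1 // gtrBl.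
have cp : 0 < c by rewrite invr_gt0.
have ex : exists n, a < (c ^+ n) ^+ K.
  have : a / (c - 1) < (Num.Def.archi_bound (a / (c - 1)))%:R.
    by rewrite archi_boundP // ltW ?divr_gt0.
  move: (Num.Def.archi_bound _) => n; rewrite ltr_pdivrMr // => an; exists n.
  have := @bernoulli_le (c - 1) n; rewrite [1 + (c - 1)]addrC subrK => /(_ (ltW cp)) h.
  have cn : a < c ^+ n by rewrite (lt_le_trans an) // (le_trans _ h) // lerDr.
  by rewrite (lt_le_trans cn) // -[leLHS]expr1 ler_weXn2l // (le_trans a1) // ltW.
(* Since [1 <= a], the least exponent is not 0; its predecessor [n] gives a power that is at most
   [a]. *)
case: (ex_minnP ex) => -[|n] an nmin.
  by rewrite expr0 expr1n ltNge a1 in an.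
exists (c ^+ n.+1); first by rewrite exprn_gt0.
rewrite an (le_lt_trans _ cK) // exprS exprMn mulrC ler_wpM2r ?exprn_ge0 ?(ltW cp) //.
by rewrite leNgt; apply/negP => /nmin; rewrite ltnn.
Qed.

(** A prime above all numerators and denominators has valuation 0 at each [r], hence valuation [K]
    at [p ^ K r], while the valuation of an [l]-th power is a multiple of [l]. *)
Lemma fresh_prime (s : seq rat) : {in s, forall r, 0 < r} ->
  exists2 p : nat, (0 < p)%N &
    {in s, forall r l K, is_pow l (p%:R ^+ K * r) -> (l %| K)%N}.
Proof.
move=> s0; pose B := \max_(r <- s) maxn `|numq r| `|denq r|.
have [p pB pp] := prime_above B.
exists p; first exact: prime_gt0.
have ndvd (c : nat) : (0 < c)%N -> (c <= B)%N -> logn p c = 0%N.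
  by move=> c0 cB; rewrite lognE pp c0 /= gtnNdvd // (leq_ltn_trans cB).
move=> r rs l K [y y0 e].
have rB : (maxn `|numq r| `|denq r| <= B)%N by rewrite /B (big_rem r) //= leq_maxl.
have [nB dB] : (`|numq r| <= B)%N /\ (`|denq r| <= B)%N.
  by move: rB; rewrite geq_max => /andP.
have num0 (z : rat) : 0 < z -> (0 < `|numq z|)%N.
  by move=> z0; rewrite absz_gt0 numq_eq0 lt0r_neq0.
have den0 (z : rat) : (0 < `|denq z|)%N by rewrite absz_gt0 denq_neq0.
have dec (z : rat) : 0 < z -> z = `|numq z|%:R / `|denq z|%:R.
  move=> z0; rewrite -[LHS]divq_num_den.
  by rewrite !natr_absz gtr0_norm ?numq_gt0 // gtr0_norm ?denq_gt0.
(* Denominators are cleared so that [logn] computes the valuations. *)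
have eN : (p ^ K * `|numq r| * `|denq y| ^ l = `|denq r| * `|numq y| ^ l)%N.
  apply/eqP; rewrite -(eqr_nat rat) !natrM !natrX.
  move: e; rewrite [in X in X -> _](dec r (s0 r rs)) [in X in X -> _](dec y y0).
  have := den0 r; have := den0 y; rewrite -!(ltr0n rat) => /lt0r_neq0 h1 /lt0r_neq0 h2.
  rewrite expr_div_n mulrA => /eqP; rewrite eqr_div ?expf_neq0 // => /eqP ->.
  by apply/eqP; rewrite mulrC.
move/(congr1 (logn p)): eN.
rewrite !lognM ?muln_gt0 ?expn_gt0 ?(prime_gt0 pp) ?num0 ?den0 ?(s0 r) //.
rewrite !lognX (logn_prime p pp) eqxx muln1 (ndvd `|numq r|%N) ?num0 ?s0 //.
rewrite (ndvd `|denq r|%N) ?den0 // addn0 add0n.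
move=> h; rewrite -(dvdn_addl _ (dvdn_mulr (logn p `|denq y|) (dvdnn l))) h.
exact: dvdn_mulr.
Qed.

(** * Solvability of a system of inequalities and coset conditions *)

(** This supplies the endpoints for [pow_dense]. Take [m] as the maximum of 0 and [L], and [b] as
    the minimum of [U] and [m + 1]; the left end is the midpoint of [m] and [b], which is positive
    even when [m = 0]. *)
Lemma separating_interval (L U : seq rat) :
  {in U, forall u, 0 < u} -> {in L & U, forall l u, l < u} ->
  exists a b, [/\ 0 < a, a < b, {in L, forall l, l <= a} & {in U, forall u, b <= u}].
Proof.
move=> U0 LU.
have [m [m0 Lm mU]] : exists m,
    [/\ 0 <= m, {in L, forall l, l <= m} & {in U, forall u, m < u}].
  elim: L LU => [|l L IH] LU; first by exists 0.
  have [|m [m0 Lm mU]] := IH; first by move=> l' u l'L uU; rewrite LU // inE l'L orbT.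
  exists (Num.max l m); split=> [|l'|u uU].
  - by rewrite le_max m0 orbT.
  - by rewrite inE le_max => /orP[/eqP ->|/Lm ->]; rewrite ?lexx ?orbT.
  - by rewrite gt_max mU // LU // mem_head.
have [b [mb bU]] : exists b, m < b /\ {in U, forall u, b <= u}.
  elim: U mU {U0 LU} => [|u U IH] mU; first by exists (m + 1); rewrite ltrDl.
  have [|b [mb bU]] := IH; first by move=> u' u'U; rewrite mU // inE u'U orbT.
  exists (Num.min u b); split=> [|u']; first by rewrite lt_min mb mU // mem_head.
  by rewrite inE ge_min => /orP[/eqP ->|/bU ->]; rewrite ?lexx ?orbT.
exists ((m + b) / 2), b; split=> [|||//]; try lra.
by move=> l /Lm ?; lra.
Qed.

Definition system (L U : seq rat) (R N : seq (nat * rat)) (y : rat) : Prop :=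
  [/\ {in L, forall l, l < y}, {in U, forall u, y < u},
      {in R, forall q, is_pow q.1 (y * q.2)} &
      {in N, forall q, ~ is_pow q.1 (y * q.2)}].

Lemma system_solvable (L U : seq rat) (R N : seq (nat * rat)) :
  {in U, forall u, 0 < u} ->
  {in R, forall q, (0 < q.1)%N && (0 < q.2)} ->
  {in N, forall q, (0 < q.1)%N && (0 < q.2)} ->
  (exists2 y, 0 < y & system L U R N y) <->
  [/\ {in L & U, forall l u, l < u},
      {in R &, forall q q', is_pow (gcdn q.1 q'.1) (q.2 / q'.2)} &
      {in N, forall q, (q.1 %| \big[lcmn/1]_(k <- unzip1 R) k)%N ->
        ~ {in R, forall q', is_pow (gcdn q.1 q'.1) (q.2 / q'.2)}}].
Proof.
move=> U0 R0 N0; set K := \big[lcmn/1]_(k <- _) k.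
have Rpos : all (ltn 0) (unzip1 R).
  by apply/allP=> _ /mapP[q qR ->]; case/andP: (R0 _ qR).
have K0 : (0 < K)%N := biglcmn_gt0 Rpos.
have divE (x y z : rat) : 0 < x -> 0 < z -> y / z = (x * y) / (x * z).
  by move=> x0 z0; rewrite -mulf_div divff ?mul1r // lt0r_neq0.
split=> [[y y0 [Ly yU yR yN]]|[LU RR NR]].
  split=> [l u lL uU|q q' qR q'R|q qN qK qR].
  - by rewrite (lt_trans (Ly _ lL)) // yU.
  - have /andP[_ q'0] := R0 _ q'R.
    rewrite (divE y) //; apply/is_powM/is_powV.
      exact/(is_pow_dvd (dvdn_gcdl _ _))/yR.
    exact/(is_pow_dvd (dvdn_gcdr _ _))/yR.
  - have /andP[q10 q20] := N0 _ qN; apply: (yN q qN).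
    (* When [q.1] divides [K] it equals [gcdn q.1 K], so the conditions modulo each [gcdn q.1 q'.1]
       combine to the forbidden one. *)
    rewrite -[q.1](gcdn_idPl qK); apply: is_pow_gcd_biglcm; rewrite ?mulr_gt0 //.
    move=> _ /mapP[q' q'R ->]; have /andP[_ q'0] := R0 _ q'R.
    have -> : y * q.2 = (q.2 / q'.2) * (y * q'.2) by field; rewrite lt0r_neq0.
    by apply: is_powM (qR _ q'R) _; apply/(is_pow_dvd (dvdn_gcdr _ _))/yR.
have [y0 y00 y0R] := is_pow_crt R0 RR.
have [|p p0 pN] := @fresh_prime [seq y0 * q.2 | q <- N].
  by move=> _ /mapP[q qN ->]; have /andP[_ q0] := N0 _ qN; rewrite mulr_gt0.
have [a [b [a0 ab La bU]]] := separating_interval U0 LU.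
(* A multiple of every modulus in [R] and [N], so a factor [r ^ K'] moves the solution into the
   interval without affecting any coset condition. *)
pose K' := (K * \prod_(l <- unzip1 N) l)%N.
have K'0 : (0 < K')%N.
  rewrite muln_gt0 K0 /= big_seq_cond prodn_cond_gt0 // => l.
  by rewrite andbT => /mapP[q qN ->]; case/andP: (N0 _ qN).
have pK0 : 0 < p%:R ^+ K :> rat by rewrite exprn_gt0 ?ltr0n.
have y10 : 0 < y0 * p%:R ^+ K by rewrite mulr_gt0.
set y1 := y0 * _ in y10.
have [||r r0 /andP[ar rb]] := @pow_dense K' (a / y1) (b / y1) K'0.
- by rewrite divr_gt0.
- by rewrite ltr_pM2r ?invr_gt0.
rewrite ltr_pdivrMr // in ar; rewrite ltr_pdivlMr // in rb.
have KR q : q \in R -> (q.1 %| K)%N by move=> qR; apply/dvdn_biglcm/map_f.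
have strip q : (q.1 %| K')%N -> is_pow q.1 (r ^+ K' * y1 * q.2) <-> is_pow q.1 (y1 * q.2).
  move=> qK; rewrite -mulrA mulrC; apply: is_powMr.
  exact/(is_pow_dvd qK)/is_powX.
have pstrip q : (q.1 %| K)%N -> is_pow q.1 (y1 * q.2) <-> is_pow q.1 (y0 * q.2).
  move=> qK; rewrite /y1 mulrAC; apply: is_powMr.
  by apply/(is_pow_dvd qK)/is_powX; rewrite ltr0n.
exists (r ^+ K' * y1); first by rewrite mulr_gt0 ?exprn_gt0.
split=> [l lL|u uU|q qR|q qN].
- by rewrite (le_lt_trans (La _ lL)).
- by rewrite (lt_le_trans rb) ?bU.
- by apply/strip; [apply/dvdn_mulr/KR|apply/pstrip; [apply: KR|apply: y0R]].
have qK' : (q.1 %| K')%N.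
  by rewrite dvdn_mull // (big_rem q.1) ?map_f //= dvdn_mulr.
move/strip => /(_ qK') y1q.
have [qK|] := boolP (q.1 %| K)%N; last first.
  move/negP; apply; apply: (pN (y0 * q.2)); first exact: (map_f (fun q => y0 * q.2)).
  by rewrite mulrA [_ * y0]mulrC.
have /andP[q10 q20] := N0 _ qN.
apply: (NR q qN qK) => q' q'R; have /andP[_ q'0] := R0 _ q'R.
rewrite (divE y0) //; apply/is_powM/is_powV.
  by apply/(is_pow_dvd (dvdn_gcdl _ _))/pstrip.
exact/(is_pow_dvd (dvdn_gcdr _ _))/y0R.
Qed.

(** * Quantifier-free definability *)

Definition ev n (a : n.-tuple qpos) (t : term n) : rat := val (eval a t).

Lemma ev_gt0 n (a : n.-tuple qpos) t : 0 < ev a t.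
Proof. exact: valP. Qed.

Lemma ev_mul n (a : n.-tuple qpos) t u : ev a (TMul t u) = ev a t * ev a u.
Proof. by []. Qed.

Lemma ev_inv n (a : n.-tuple qpos) t : ev a (TInv t) = (ev a t)^-1.
Proof. by []. Qed.

Definition qf_definable n (P : n.-tuple qpos -> Prop) : Prop :=
  exists2 psi : formula n, quantifier_free psi & forall a, P a <-> holds psi a.

Section QfDefinable.
Variable n : nat.
Implicit Types (P Q : n.-tuple qpos -> Prop) (t u : term n).

Lemma qf_ext P Q : (forall a, P a <-> Q a) -> qf_definable P -> qf_definable Q.
Proof. by move=> PQ [f qf fP]; exists f => // a; rewrite -PQ. Qed.

Lemma qf_not P : qf_definable P -> qf_definable (fun a => ~ P a).
Proof. by move=> [f qf fP]; exists (FNot f) => //= a; rewrite fP. Qed.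

Lemma qf_and P Q : qf_definable P -> qf_definable Q -> qf_definable (fun a => P a /\ Q a).
Proof.
by move=> [f qf fP] [g qg gQ]; exists (FAnd f g) => [|a] /=; rewrite ?qf // fP gQ.
Qed.

Lemma qf_or P Q : qf_definable P -> qf_definable Q -> qf_definable (fun a => P a \/ Q a).
Proof.
by move=> [f qf fP] [g qg gQ]; exists (FOr f g) => [|a] /=; rewrite ?qf // fP gQ.
Qed.

Lemma qf_imp P Q : qf_definable P -> qf_definable Q -> qf_definable (fun a => P a -> Q a).
Proof.
by move=> [f qf fP] [g qg gQ]; exists (FImp f g) => [|a] /=; rewrite ?qf // fP gQ.
Qed.

Lemma qf_const (A : bool) : qf_definable (fun _ : n.-tuple qpos => A : Prop).
Proof.
case: A; first by exists (FEq TOne TOne).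
by exists (FNot (FEq TOne TOne)) => //= a; split=> // /(_ erefl).
Qed.

Lemma qf_eq t u : qf_definable (fun a => ev a t = ev a u).
Proof. by exists (FEq t u) => // a; split=> [/val_inj//|]; rewrite /ev /= => ->. Qed.

Lemma qf_lt t u : qf_definable (fun a => ev a t < ev a u).
Proof. by exists (FLt t u). Qed.

Lemma is_powE k (x : qpos) : qpos_is_power k x <-> is_pow k (val x).
Proof.
split=> [[y ->]|[y y0 e]]; first by exists (val y); rewrite ?(valP y).
by exists (exist _ y y0).
Qed.

Lemma qf_pow k t : (0 < k)%N -> qf_definable (fun a => is_pow k (ev a t)).
Proof.
case: k => [|[|k]] // _.
  (* The language has no [R_1], but a gcd of moduli may be 1; every positive rational is a first
     power. *)
  by apply: (qf_ext _ (qf_const true)) => a; split=> // _; apply/is_pow1/ev_gt0.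
by exists (@FRoot n k.+2 isT t) => // a; rewrite /= is_powE.
Qed.

(** The list [s] is fixed and only its image depends on [a], so the bounded quantifier is a finite
    conjunction. *)
Lemma qf_all (T : Type) (Y : eqType) (g : n.-tuple qpos -> T -> Y)
    (P : n.-tuple qpos -> Y -> Prop) (p : pred T) (s : seq T) :
  all p s -> (forall q, p q -> qf_definable (fun a => P a (g a q))) ->
  qf_definable (fun a => {in [seq g a q | q <- s], forall y, P a y}).
Proof.
move=> + gP; elim: s => [_|q s IH /=/andP[pq /IH{}IH]].
  by apply: (qf_ext _ (qf_const true)) => a; split=> // _ y.
apply: (qf_ext _ (qf_and (gP q pq) IH)) => a; split=> [[Pq Ps] y|H].
  by rewrite inE => /orP[/eqP ->|/Ps].
by split=> [|y ys]; apply: H; rewrite inE ?eqxx // ys orbT.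
Qed.

End QfDefinable.

(* A conjunction of literals in the parameters and in a variable y, each of
   which has the form y = t, t < y, y < t, R_k (y t) or ~ R_k (y t). *)
Record clause n := Clause {
  cond : formula n;
  eqs : seq (term n);
  los : seq (term n);
  ups : seq (term n);
  pows : seq (nat * term n);
  npows : seq (nat * term n)
}.

Definition clause_wf n (c : clause n) : bool :=
  [&& quantifier_free (cond c), all (fun q => 0 < q.1)%N (pows c) &
      all (fun q => 0 < q.1)%N (npows c)].

Definition evs n (a : n.-tuple qpos) (s : seq (term n)) : seq rat :=
  [seq ev a t | t <- s].

Definition evps n (a : n.-tuple qpos) (s : seq (nat * term n)) : seq (nat * rat) :=
  [seq (q.1, ev a q.2) | q <- s].

Lemma evs_gt0 n (a : n.-tuple qpos) s : {in evs a s, forall x, 0 < x}.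
Proof.
by elim: s => //= t s IH x; rewrite inE => /orP[/eqP ->|/IH //]; apply: ev_gt0.
Qed.

Lemma evps_gt0 n (a : n.-tuple qpos) s : all (fun q => 0 < q.1)%N s ->
  {in evps a s, forall q, (0 < q.1)%N && (0 < q.2)}.
Proof.
elim: s => //= q s IH /andP[q0 /IH{}IH] q'.
by rewrite inE => /orP[/eqP ->|/IH //]; rewrite q0 ev_gt0.
Qed.

Lemma unzip1_evps n (a : n.-tuple qpos) s : unzip1 (evps a s) = unzip1 s.
Proof. by rewrite /unzip1 -map_comp. Qed.

Definition clause_holds n (c : clause n) (a : n.-tuple qpos) (y : rat) : Prop :=
  [/\ holds (cond c) a, {in evs a (eqs c), forall t, y = t} &
      system (evs a (los c)) (evs a (ups c)) (evps a (pows c)) (evps a (npows c)) y].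

Definition clause_and n (c c' : clause n) : clause n :=
  Clause (FAnd (cond c) (cond c')) (eqs c ++ eqs c') (los c ++ los c')
    (ups c ++ ups c') (pows c ++ pows c') (npows c ++ npows c').

Lemma in_cat_all (T : eqType) (P : T -> Prop) (s s' : seq T) :
  {in s ++ s', forall x, P x} <-> {in s, forall x, P x} /\ {in s', forall x, P x}.
Proof.
split=> [H|[H H'] x].
  by split=> x xs; apply: H; rewrite mem_cat xs ?orbT.
by rewrite mem_cat => /orP[/H|/H'].
Qed.

Lemma clause_andP n (c c' : clause n) a y :
  clause_holds (clause_and c c') a y <-> clause_holds c a y /\ clause_holds c' a y.
Proof.
rewrite /clause_holds /system /evs /evps /= !map_cat.
split=> [[[? ?] /in_cat_all[? ?] [/in_cat_all[? ?] /in_cat_all[? ?]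
    /in_cat_all[? ?] /in_cat_all[? ?]]]|].
  by [].
move=> [[? ? [? ? ? ?]] [? ? [? ? ? ?]]].
by split; [| |split]; try split; try apply/in_cat_all.
Qed.

Lemma clause_and_wf n (c c' : clause n) :
  clause_wf c -> clause_wf c' -> clause_wf (clause_and c c').
Proof.
by rewrite /clause_wf /= !all_cat => /and3P[-> -> ->] /and3P[-> -> ->].
Qed.

Lemma qf_clause_at n (c : clause n) (t : term n) : clause_wf c ->
  qf_definable (fun a => clause_holds c a (ev a t)).
Proof.
move=> /and3P[qc pc nc].
have [C E L U] : [/\ qf_definable (holds (cond c)),
  qf_definable (fun a => {in evs a (eqs c), forall u, ev a t = u}),
  qf_definable (fun a => {in evs a (los c), forall u, u < ev a t}) &
  qf_definable (fun a => {in evs a (ups c), forall u, ev a t < u})].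
  split; first by exists (cond c).
  - apply: (@qf_all _ _ _ _ (fun a u => ev a t = u) predT); rewrite ?all_predT // => q _.
    exact: qf_eq.
  - apply: (@qf_all _ _ _ _ (fun a u => u < ev a t) predT); rewrite ?all_predT // => q _.
    exact: qf_lt.
  - apply: (@qf_all _ _ _ _ (fun a u => ev a t < u) predT); rewrite ?all_predT // => q _.
    exact: qf_lt.
have P : qf_definable
    (fun a => {in evps a (pows c), forall q, is_pow q.1 (ev a t * q.2)}).
  apply: (@qf_all _ _ _ _ (fun a q => is_pow q.1 (ev a t * q.2)) _ _ pc) => q q0.
  exact: (qf_pow (TMul t q.2)).
have N : qf_definable
    (fun a => {in evps a (npows c), forall q, ~ is_pow q.1 (ev a t * q.2)}).
  apply: (@qf_all _ _ _ _ (fun a q => ~ is_pow q.1 (ev a t * q.2)) _ _ nc) => q q0.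
  exact/qf_not/(qf_pow (TMul t q.2)).
apply: (qf_ext _ (qf_and (qf_and C E) (qf_and (qf_and L U) (qf_and P N)))) => a.
split; first by case=> -[? ?] [[? ?] [? ?]].
by case=> ? ? [? ? ? ?].
Qed.

(** If there is an equation, its term is the only candidate for [y]. If not, each condition in
    [system_solvable] is expressible in the parameters. *)
Lemma qf_clause_ex n (c : clause n) : clause_wf c ->
  qf_definable (fun a => exists2 y, 0 < y & clause_holds c a y).
Proof.
move=> wfc; case eqE : (eqs c) => [|t s]; last first.
  apply: (qf_ext _ (qf_clause_at t wfc)) => a; split=> [H|[y y0 H]].
    by exists (ev a t); rewrite ?ev_gt0.
  have [_ Ey _] := H; suff <- : y = ev a t by [].
  by apply: Ey; rewrite eqE /= mem_head.
have /and3P[qc pc nc] := wfc.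
have C : qf_definable (holds (cond c)) by exists (cond c).
have LU : qf_definable (fun a => {in evs a (los c) & evs a (ups c), forall l u, l < u}).
  have : qf_definable
      (fun a => {in evs a (los c), forall l, {in evs a (ups c), forall u, l < u}}).
    pose P a (l : rat) := {in evs a (ups c), forall u, l < u}.
    apply: (@qf_all _ _ _ _ P predT); rewrite ?all_predT // => l _.
    apply: (@qf_all _ _ _ _ (fun a u => ev a l < u) predT); rewrite ?all_predT // => u _.
    exact: qf_lt.
  by apply: qf_ext => a; split=> H l u lL; apply: H.
pose compat (s : seq (nat * rat)) (q : nat * rat) :=
  {in s, forall q', is_pow (gcdn q.1 q'.1) (q.2 / q'.2)}.
have qf_compat q : (0 < q.1)%N ->
    qf_definable (fun a => compat (evps a (pows c)) (q.1, ev a q.2)).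
  move=> q0.
  pose P a (q' : nat * rat) := is_pow (gcdn q.1 q'.1) (ev a q.2 / q'.2).
  apply: (@qf_all _ _ _ _ P _ _ pc) => q' q'0.
  have g0 : (0 < gcdn q.1 q'.1)%N by rewrite gcdn_gt0 q0.
  exact: (qf_pow (TMul q.2 (TInv q'.2)) g0).
have RR : qf_definable (fun a => {in evps a (pows c) &, forall q q',
    is_pow (gcdn q.1 q'.1) (q.2 / q'.2)}).
  have : qf_definable
      (fun a => {in evps a (pows c), forall q, compat (evps a (pows c)) q}).
    apply: (@qf_all _ _ _ _ (fun a q => compat (evps a (pows c)) q) _ _ pc) => q.
    exact: qf_compat.
  by apply: qf_ext => a; split=> H q q' qL; apply: H.
have NR : qf_definable (fun a => {in evps a (npows c), forall q,
    (q.1 %| \big[lcmn/1]_(k <- unzip1 (pows c)) k)%N ->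
    ~ compat (evps a (pows c)) q}).
  pose P a (q : nat * rat) := (q.1 %| \big[lcmn/1]_(k <- unzip1 (pows c)) k)%N ->
    ~ compat (evps a (pows c)) q.
  apply: (@qf_all _ _ _ _ P _ _ nc) => q q0.
  (* The moduli do not depend on [a], so the divisibility is a constant truth value. *)
  exact: (qf_imp (qf_const n (q.1 %| _)%N) (qf_not (qf_compat _ q0))).
apply: (qf_ext _ (qf_and (qf_and C LU) (qf_and RR NR))) => a.
have [to from] := system_solvable (evs a (los c)) (@evs_gt0 _ a (ups c))
  (evps_gt0 (a := a) pc) (evps_gt0 (a := a) nc).
rewrite unzip1_evps in to from.
split=> [[[Ca LUa] [RRa NRa]]|[y y0 [Ca _ sy]]].
  by have [//|y y0 sy] := from; exists y => //; split; rewrite // eqE.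
by have [//|? ? ?] := to; first by exists y.
Qed.

(** * Disjunctive normal forms in one positive variable *)

Inductive dnf n : (n.-tuple qpos -> rat -> Prop) -> Prop :=
| dnf_clause (c : clause n) P : clause_wf c ->
    (forall a y, 0 < y -> P a y <-> clause_holds c a y) -> dnf P
| dnf_or P Q S : dnf P -> dnf Q ->
    (forall a y, 0 < y -> S a y <-> P a y \/ Q a y) -> dnf S.

(** Conjunction distributes over the disjunctions on both sides, down to pairs of clauses, which
    merge by [clause_and]. *)
Lemma dnf_and n (P Q : n.-tuple qpos -> rat -> Prop) :
  dnf P -> dnf Q -> dnf (fun a y => P a y /\ Q a y).
Proof.
move=> dP dQ; elim: dP => {P} [c P wfc HP|P1 P2 P _ IH1 _ IH2 HP]; last first.
  by apply: dnf_or IH1 IH2 _ => a y y0; rewrite HP //; tauto.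
elim: dQ => {Q} [c' Q wfc' HQ|Q1 Q2 Q _ IH1 _ IH2 HQ]; last first.
  by apply: dnf_or IH1 IH2 _ => a y y0; rewrite HQ //; tauto.
apply: dnf_clause (clause_and_wf wfc wfc') _ => a y y0.
by rewrite clause_andP HP // HQ.
Qed.

Lemma qf_dnf_ex n (P : n.-tuple qpos -> rat -> Prop) : dnf P ->
  qf_definable (fun a => exists2 y, 0 < y & P a y).
Proof.
elim=> {P} [c P wfc H|P Q S _ IHP _ IHQ H].
  apply: (qf_ext _ (qf_clause_ex wfc)) => a.
  by split=> -[y y0 Hy]; exists y => //; apply/H.
apply: (qf_ext _ (qf_or IHP IHQ)) => a; split.
  by case=> -[y y0 Hy]; exists y => //; apply/H => //; [left|right].
by move=> [y y0 /H -/(_ y0)[Hy|Hy]]; [left|right]; exists y.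
Qed.

Section Literals.
Variable n : nat.
Implicit Types (t : term n) (k : nat).

Let true_ : formula n := FEq TOne TOne.

Lemma dnf_param (P : n.-tuple qpos -> Prop) : qf_definable P -> dnf (fun a _ => P a).
Proof.
move=> [f qf fP]; apply: (@dnf_clause _ (Clause f [::] [::] [::] [::] [::])).
  by rewrite /clause_wf /= qf.
by move=> a y _; rewrite fP; split=> [H|[]].
Qed.

Lemma dnf_eq t : dnf (fun a y => y = ev a t).
Proof.
apply: (@dnf_clause _ (Clause true_ [:: t] [::] [::] [::] [::])) => // a y _.
split=> [yt|[_ + _]]; last by apply; rewrite mem_head.
by split=> // u; rewrite inE => /eqP ->.
Qed.

Lemma dnf_gt t : dnf (fun a y => ev a t < y).
Proof.
apply: (@dnf_clause _ (Clause true_ [::] [:: t] [::] [::] [::])) => // a y _.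
split=> [ty|[_ _ [+ _ _ _]]]; last by apply; rewrite mem_head.
by split=> //; split=> // u; rewrite inE => /eqP ->.
Qed.

Lemma dnf_lt t : dnf (fun a y => y < ev a t).
Proof.
apply: (@dnf_clause _ (Clause true_ [::] [::] [:: t] [::] [::])) => // a y _.
split=> [ty|[_ _ [_ + _ _]]]; last by apply; rewrite mem_head.
by split=> //; split=> // u; rewrite inE => /eqP ->.
Qed.

Lemma dnf_pow k t : (0 < k)%N -> dnf (fun a y => is_pow k (y * ev a t)).
Proof.
move=> k0; apply: (@dnf_clause _ (Clause true_ [::] [::] [::] [:: (k, t)] [::])).
  by rewrite /clause_wf /= k0.
move=> a y _; split=> [ty|[_ _ [_ _ H _]]]; last exact: (H (k, ev a t) (mem_head _ _)).
by split=> //; split=> // u; rewrite inE => /eqP ->.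
Qed.

Lemma dnf_npow k t : (0 < k)%N -> dnf (fun a y => ~ is_pow k (y * ev a t)).
Proof.
move=> k0; apply: (@dnf_clause _ (Clause true_ [::] [::] [::] [::] [:: (k, t)])).
  by rewrite /clause_wf /= k0.
move=> a y _; split=> [ty|[_ _ [_ _ _ H]]]; last exact: (H (k, ev a t) (mem_head _ _)).
by split=> //; split=> // u; rewrite inE => /eqP ->.
Qed.

End Literals.

Definition tcons n (x : qpos) (a : n.-tuple qpos) : n.+1.-tuple qpos :=
  [tuple of x :: a].

(** * Reduction to literals in a power of the variable *)

(* [S] becomes a disjunction of conjunctions of literals in y = x^M once M is
   divisible enough. *)
Definition uniformizable n (S : n.+1.-tuple qpos -> Prop) : Prop :=
  exists2 M0, (0 < M0)%N & forall M, (0 < M)%N -> (M0 %| M)%N ->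
    exists2 P, dnf P & forall a (x : qpos), S (tcons x a) <-> P a (val x ^+ M).

Lemma uniformizable_ext n (S T : n.+1.-tuple qpos -> Prop) :
  (forall a, S a <-> T a) -> uniformizable S -> uniformizable T.
Proof.
move=> ST [M0 M00 H]; exists M0 => // M M1 M2; have [P dP SP] := H M M1 M2.
by exists P => // a x; rewrite -ST SP.
Qed.

Lemma uniformizable_and n (S T : n.+1.-tuple qpos -> Prop) :
  uniformizable S -> uniformizable T -> uniformizable (fun a => S a /\ T a).
Proof.
move=> [M M_gt0 HS] [N N_gt0 HT]; exists (M * N)%N; first by rewrite muln_gt0 M_gt0.
move=> K K0 dK.
have [P dP SP] := HS K K0 (dvdn_trans (dvdn_mulr _ (dvdnn _)) dK).
have [Q dQ TQ] := HT K K0 (dvdn_trans (dvdn_mull _ (dvdnn _)) dK).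
by exists (fun a y => P a y /\ Q a y); [apply: dnf_and|move=> a x; rewrite SP TQ].
Qed.

Lemma uniformizable_or n (S T : n.+1.-tuple qpos -> Prop) :
  uniformizable S -> uniformizable T -> uniformizable (fun a => S a \/ T a).
Proof.
move=> [M M_gt0 HS] [N N_gt0 HT]; exists (M * N)%N; first by rewrite muln_gt0 M_gt0.
move=> K K0 dK.
have [P dP SP] := HS K K0 (dvdn_trans (dvdn_mulr _ (dvdnn _)) dK).
have [Q dQ TQ] := HT K K0 (dvdn_trans (dvdn_mull _ (dvdnn _)) dK).
by exists (fun a y => P a y \/ Q a y); [apply: dnf_or dP dQ _|move=> a x; rewrite SP TQ].
Qed.

Lemma ev_cons n (t : term n.+1) : exists m : int, exists u : term n,
  forall a x, ev (tcons x a) t = val x ^ m * ev a u.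
Proof.
have x0 (x : qpos) : val x \is a GRing.unit by rewrite unitfE lt0r_neq0 // (valP x).
elim: t => [i||t [m [u tu]] t' [m' [u' tu']]|t [m [u tu]]].
- case: (unliftP ord0 i) => [j ->|->].
    by exists 0, (TVar j) => a x; rewrite /ev /= /tcons tnthS expr0z mul1r.
  by exists 1, TOne => a x; rewrite /ev /= /tcons tnth0 expr1z mulr1.
- by exists 0, TOne => a x; rewrite expr0z mul1r.
- exists (m + m'), (TMul u u') => a x.
  by rewrite !ev_mul tu tu' exprzDr // mulrACA.
- exists (- m), (TInv u) => a x.
  by rewrite !ev_inv tu invfM invr_expz.
Qed.

Lemma ev_pow n (u : term n) k : exists w : term n, forall a, ev a w = ev a u ^+ k.
Proof.
elim: k => [|k [w wu]]; first by exists TOne.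
by exists (TMul u w) => a; rewrite ev_mul wu exprS.
Qed.

Definition signed n (b : bool) (t : term n) : term n := if b then TInv t else t.

(** Write [t] as [x ^ m * u]. If [m] is not 0 and [M = e * |m|], then [t], inverted when [m < 0],
    has an [e]-th power in which [x] occurs exactly as [x ^ M]. *)
Lemma ev_uniform n (t : term n.+1) : exists2 M0, (0 < M0)%N &
  forall M, (0 < M)%N -> (M0 %| M)%N ->
    (exists u, forall a x, ev (tcons x a) t = ev a u) \/
    (exists b e w, (0 < e)%N /\
       forall a (x : qpos), ev (tcons x a) (signed b t) ^+ e = val x ^+ M / ev a w).
Proof.
have [m [u tu]] := ev_cons t.
have [m0|mn0] := eqVneq m 0.
  exists 1%N => // M _ _; left; exists u => a x.
  by rewrite tu m0 expr0z mul1r.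
exists `|m|%N; first by rewrite absz_gt0.
move=> M M0 /dvdnP[e eM]; right.
have e0 : (0 < e)%N by move: M0; rewrite eM muln_gt0 => /andP[].
have [w wu] := ev_pow u e.
exists (m < 0), e, (signed (m >= 0) w); split=> // a x.
rewrite eM mulnC exprM.
case: (ltP m 0) => sm; rewrite /signed ?ev_inv tu wu.
  rewrite invfM exprMn.
  congr (_ ^+ _ * _); last by rewrite exprVn.
  by rewrite invr_expz -(ltz0_abs sm).
rewrite exprMn invrK; congr (_ ^+ _ * _).
by rewrite -{1}(gez0_abs sm).
Qed.

Section UniformLiterals.
Variables (n : nat) (t : term n.+1).

Let uniformizable_literal (S : n.+1.-tuple qpos -> Prop) :
  (forall u, (forall a x, ev (tcons x a) t = ev a u) ->
     exists2 C, qf_definable C & forall a x, S (tcons x a) <-> C a) ->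
  (forall M b e w, (0 < e)%N ->
     (forall a x, ev (tcons x a) (signed b t) ^+ e = val x ^+ M / ev a w) ->
     exists2 P, dnf P & forall a x, S (tcons x a) <-> P a (val x ^+ M)) ->
  uniformizable S.
Proof.
move=> Hu Hs; have [M0 M00 H] := ev_uniform t; exists M0 => // M Mpos dM.
have [[u tu]|[b [e [w [e0 tw]]]]] := H M Mpos dM; last exact: Hs e0 tw.
have [C qC SC] := Hu u tu.
by exists (fun a _ => C a) => //; apply: dnf_param.
Qed.

Lemma uniformizable_eq1 : uniformizable (fun a => ev a t = 1).
Proof.
apply: uniformizable_literal => [u tu|M b e w e0 tw].
  by exists (fun a => ev a u = 1) => [|a x]; [apply: (qf_eq u TOne)|rewrite tu].
exists (fun a y => y = ev a w) => [|a x]; first exact: dnf_eq.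
have w0 := lt0r_neq0 (ev_gt0 a w).
have <- : (ev (tcons x a) (signed b t) ^+ e == 1) <-> val x ^+ M = ev a w.
  by rewrite tw -[X in _ == X](divff w0) (inj_eq (mulIf (invr_neq0 w0))); split=> /eqP.
rewrite pexpr_eq1 ?ltW ?ev_gt0 //.
by case: b {tw}; rewrite /signed ?ev_inv ?invr_eq1; split=> /eqP.
Qed.

Lemma uniformizable_lt1 : uniformizable (fun a => ev a t < 1).
Proof.
apply: uniformizable_literal => [u tu|M b e w e0 tw].
  by exists (fun a => ev a u < 1) => [|a x]; [apply: (qf_lt u TOne)|rewrite tu].
(* Inverting [t] reverses its comparison with 1, so [b] decides between a lower and an upper
   bound. *)
exists (fun a y => if b then ev a w < y else y < ev a w) => [|a x].
  by case: b {tw}; [apply: dnf_gt|apply: dnf_lt].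
have w0 := ev_gt0 a w; have t0 := ev_gt0 (tcons x a) t.
case: b tw => /(_ a x) tw.
  by rewrite -invf_gt1 // -ev_inv -(expr_gt1 e0) ?ltW ?ev_gt0 // tw ltr_pdivlMr // mul1r.
by rewrite -(expr_lt1 e0) ?ltW // tw ltr_pdivrMr // mul1r.
Qed.

Lemma is_pow_signed k b (a : n.+1.-tuple qpos) :
  is_pow k (ev a (signed b t)) <-> is_pow k (ev a t).
Proof.
case: b => //; rewrite ev_inv; split; last exact: is_powV.
by move/is_powV; rewrite invrK.
Qed.

Lemma uniformizable_pow k : (0 < k)%N -> uniformizable (fun a => is_pow k (ev a t)).
Proof.
move=> k0; apply: uniformizable_literal => [u tu|M b e w e0 tw].
  by exists (fun a => is_pow k (ev a u)) => [|a x]; [apply: qf_pow|rewrite tu].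
exists (fun a y => is_pow (k * e) (y * ev a (TInv w))) => [|a x].
  by apply: dnf_pow; rewrite muln_gt0 k0.
by rewrite -(is_pow_signed k b) -(is_powXX k e0) ?ev_gt0 // tw.
Qed.

Lemma uniformizable_npow k : (0 < k)%N -> uniformizable (fun a => ~ is_pow k (ev a t)).
Proof.
move=> k0; apply: uniformizable_literal => [u tu|M b e w e0 tw].
  by exists (fun a => ~ is_pow k (ev a u)) => [|a x]; [apply/qf_not/qf_pow|rewrite tu].
exists (fun a y => ~ is_pow (k * e) (y * ev a (TInv w))) => [|a x].
  by apply: dnf_npow; rewrite muln_gt0 k0.
by rewrite -(is_pow_signed k b) -(is_powXX k e0) ?ev_gt0 // tw.
Qed.

End UniformLiterals.

(** * Elimination of quantifiers *)

Lemma qf_uniformizable_ex n (S : n.+1.-tuple qpos -> Prop) :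
  uniformizable S -> qf_definable (fun a => exists x, S (tcons x a)).
Proof.
move=> [M M0 /(_ M M0 (dvdnn M))[P dP SP]].
(* The added literal, with trivial coset parameter [TOne], says that [y] is an [M]-th power and so
   lets [x] be recovered as its root. *)
apply: (qf_ext _ (qf_dnf_ex (dnf_and dP (dnf_pow TOne M0)))) => a; split.
  move=> [y y0 [Py]]; rewrite mulr1 => -[x x0 yx].
  by exists (exist _ x x0); apply/SP; rewrite /= -yx.
move=> [x /SP Px]; have x0 : 0 < val x := valP x.
by exists (val x ^+ M); rewrite ?exprn_gt0 //; split=> //; rewrite mulr1; exists (val x).
Qed.

(** The match lets an induction on formulas of arbitrary index speak of index [n.+1] only. The
    negation is carried along because normal forms are not visibly closed under it. *)
Definition uniformizable_formula n : formula n -> Prop :=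
  match n with
  | 0 => fun=> True
  | n.+1 => fun phi => quantifier_free phi ->
      uniformizable (holds phi) /\ uniformizable (fun a => ~ holds phi a)
  end.

(** Negations are pushed down to the atoms by classical logic; a negated comparison becomes a
    disjunction of comparisons because the order is linear. *)
Lemma qf_uniformizable n (phi : formula n) : uniformizable_formula phi.
Proof.
elim: phi => {n} -[|n] //=.
- move=> t u _.
  have eq1 a : ev a (TMul t (TInv u)) = 1 <-> eval a t = eval a u.
    split=> [|e].
      by rewrite ev_mul ev_inv => /divr1_eq; apply: val_inj.
    by rewrite ev_mul ev_inv /ev e divff // lt0r_neq0 // (valP (eval a u)).
  split; first exact: uniformizable_ext eq1 (uniformizable_eq1 _).
  apply: uniformizable_ext (uniformizable_or (uniformizable_lt1 (TMul t (TInv u)))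
    (uniformizable_lt1 (TMul u (TInv t)))) => a.
  rewrite -eq1 !ev_mul !ev_inv !ltr_pdivrMr ?ev_gt0 // !mul1r.
  have u0 := lt0r_neq0 (ev_gt0 a u).
  split=> [tu /divr1_eq e|]; first by move: tu; rewrite e ltxx; case.
  case: (ltgtP (ev a t) (ev a u)) => [||->]; [by left|by right|].
  by rewrite divff.
- move=> t u _.
  have lt1 a : ev a (TMul t (TInv u)) < 1 <-> qpos_lt (eval a t) (eval a u).
    by rewrite ev_mul ev_inv ltr_pdivrMr ?ev_gt0 // mul1r.
  split; first exact: uniformizable_ext lt1 (uniformizable_lt1 _).
  apply: uniformizable_ext (uniformizable_or (uniformizable_eq1 (TMul t (TInv u)))
    (uniformizable_lt1 (TMul u (TInv t)))) => a.
  rewrite -lt1 !ev_mul !ev_inv !ltr_pdivrMr ?ev_gt0 // !mul1r.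
  have u0 := lt0r_neq0 (ev_gt0 a u).
  split=> [[/divr1_eq ->|ut]|]; first by rewrite ltxx.
    by rewrite ltNge ltW.
  case: (ltgtP (ev a t) (ev a u)) => [//| |->]; first by right.
  by left; rewrite divff.
- move=> k k2 t _; have k0 : (0 < k)%N by apply: ltn_trans k2.
  split; first by apply: uniformizable_ext (uniformizable_pow t k0) => a; rewrite is_powE.
  by apply: uniformizable_ext (uniformizable_npow t k0) => a; rewrite is_powE.
- move=> f IH qf; have [pos neg] := IH qf; split=> //.
  apply: uniformizable_ext pos => a; split=> [? //|]; exact: NNPP.
- move=> f IHf g IHg /andP[/IHf[fp fn] /IHg[gp gn]].
  split; first exact: uniformizable_and.
  by apply: uniformizable_ext (uniformizable_or fn gn) => a;
    have := classic (holds f a); tauto.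
- move=> f IHf g IHg /andP[/IHf[fp fn] /IHg[gp gn]].
  split; first exact: uniformizable_or.
  by apply: uniformizable_ext (uniformizable_and fn gn) => a; tauto.
- move=> f IHf g IHg /andP[/IHf[fp fn] /IHg[gp gn]].
  split.
    by apply: uniformizable_ext (uniformizable_or fn gp) => a;
      have := classic (holds f a); tauto.
  by apply: uniformizable_ext (uniformizable_and fp gn) => a;
    have := classic (holds f a); tauto.
Qed.

Lemma qf_ex n (P : n.+1.-tuple qpos -> Prop) :
  qf_definable P -> qf_definable (fun a => exists x, P (tcons x a)).
Proof.
move=> [f qf fP]; have /(_ qf)[fu _] := @qf_uniformizable n.+1 f.
by apply: qf_uniformizable_ex; apply: uniformizable_ext fu => a; rewrite fP.
Qed.

Lemma qf_holds n (phi : formula n) : qf_definable (holds phi).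
Proof.
elim: phi => {n} n.
- by move=> t u; exists (FEq t u).
- by move=> t u; exists (FLt t u).
- by move=> k k2 t; exists (FRoot k2 t).
- by move=> f; apply: qf_not.
- by move=> f IHf g IHg; apply: qf_and.
- by move=> f IHf g IHg; apply: qf_or.
- by move=> f IHf g IHg; apply: qf_imp.
(* The universal quantifier is treated as the classical dual of the existential one. *)
- move=> f IH; apply: (qf_ext _ (qf_not (qf_ex (qf_not IH)))) => a.
  split=> [H x|H [x]]; last by apply; apply: H.
  by apply: NNPP => nf; apply: H; exists x.
- by move=> f /qf_ex.
Qed.

Theorem mainTheorem3 (n : nat) (phi : formula n) :
  exists psi : formula n,
    quantifier_free psi /\
    forall a : n.-tuple qpos, holds phi a <-> holds psi a.
Proof. by have [psi qf e] := qf_holds phi; exists psi. Qed.
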